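(* Let $p>3$ be a prime, let $G$ be the additive group $(\mathbb{Z}/p\mathbb{Z})^2$, and let $S_2=\{(x,x^2): x\in\mathbb{Z}/p\mathbb{Z}\}\subseteq G$. Then the cop number of the directed Cayley graph $\mathrm{Cay}(G,S_2)$ is equal to $|S_2|=p=\sqrt{|G|}$.
   Context: Cops and robbers on a finite strongly connected digraph: first each cop chooses a starting vertex, then the robber chooses a starting vertex. Then cop turns and robber turns alternate, starting with a cop turn. On a cop turn each cop either stays where it is or moves along an arc, in the direction of the arc, to an out-neighbour; on a robber turn the robber does likewise. Several cops may share a vertex, and all players have full information. The cops win if at some point a cop shares a vertex with the robber; the robber wins if this never happens. The cop number is the minimum number of cops for which the cops have a winning strategy. $\mathrm{Cay}(G,S_2)$ is the digraph with vertex set $G$ containing the arc from $u$ to $v$ iff $v-u\in S_2$. Here $0_G\in S_2$ is allowed: choosing the move $0_G$ simply means staying in place, so the game is the same as on the digraph with connection set $S_2\setminus\{0_G\}$. The set $S_2$ generates $G$. *)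

(* Defs.v *)
From HB Require Import structures.
From mathcomp Require Import all_boot all_order all_algebra.
From mathcomp Require Import boolp.

Set Implicit Arguments.
Unset Strict Implicit.
Unset Printing Implicit Defensive.

Import GRing.Theory.
Local Open Scope ring_scope.

Section CopsAndRobbers.
Variables (T : finType) (e : rel T).

Definition stay_or_move : rel T := [rel u v | (u == v) || e u v].

(* A strategy for k cops maps the list of all robber positions so far (oldest
   first) to the current cop positions: [sigma [::]] is the initial placement,
   made before the robber appears, and [sigma [:: r_0; ...; r_n]] is the
   placement after the cop turn that follows the robber's arrival at r_n.  The
   cops' own past moves are determined by sigma and this list, so this is a
   full-information, history-dependent strategy. *)
Definition cop_strategy (k : nat) := seq T -> 'I_k -> T.

Definition legal_strategy k (sigma : cop_strategy k) : Prop :=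
  forall (h : seq T) (r : T) (i : 'I_k),
    stay_or_move (sigma h i) (sigma (rcons h r) i).

(* [r 0] is the robber's starting vertex, [r n] its position after n turns. *)
Definition robber_play (r : nat -> T) : Prop :=
  forall n, stay_or_move (r n) (r n.+1).

(* While the robber is on [r n], the cops are first at [sigma (mkseq r n)] (the
   robber has just arrived), then at [sigma (mkseq r n.+1)] (after their turn).
   The play formally goes on after a capture, which does not affect the winner.
*)
Definition captured k (sigma : cop_strategy k) (r : nat -> T) : Prop :=
  exists n (i : 'I_k), sigma (mkseq r n) i = r n \/ sigma (mkseq r n.+1) i = r n.

Definition winning_strategy k (sigma : cop_strategy k) : Prop :=
  legal_strategy sigma /\ forall r, robber_play r -> captured sigma r.

Definition cops_win (k : nat) : Prop :=
  exists sigma : cop_strategy k, winning_strategy sigma.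

Lemma cops_win_exists : exists k, `[< cops_win k >].
Proof.
exists #|T|; apply/asboolP; exists (fun _ i => enum_val i).
split=> [h r i | r _]; first by rewrite /stay_or_move /= eqxx.
by exists 0%N, (enum_rank (r 0%N)); left; rewrite enum_rankK.
Qed.

Definition cop_number : nat := ex_minn cops_win_exists.

End CopsAndRobbers.

HB.instance Definition _ (U V : finZmodType) :=
  GRing.Zmodule.on (U * V)%type.

Definition Cay (G : finZmodType) (S : {set G}) : rel G :=
  [rel u v | v - u \in S].

Definition S2 (p : nat) : {set 'F_p * 'F_p} := [set (x, x ^+ 2) | x : 'F_p].

(* Main.v *)
(** Write [s_x = (x, x^2)].

    Lower bound: if a cop is at nonzero distance [g] from the robber, then
    [g + s_x = s_y] is a linear equation in [x] with at most one solution, so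
    a cop guards at most one of the [p] moves of the robber, and fewer than [p]
    cops leave one of them safe.

    Upper bound: let most cops copy each move of the robber, so that their
    difference with the robber is constant.  A cop whose difference lies on the
    line spanned by [s_x] makes the robber use [s_x] fewer than [p] times, by
    standing still whenever [s_x] is played.  Let [A] be the set of nonzero [x]
    to which such a cop is assigned, and let [x] be a nonzero element outside
    [A].  Modulo [s_x] the group is cyclic of prime order, so the same device,
    with one unassigned cop for each move [s_z] outside [A] and cop [x]
    walking when the robber plays [0] or [s_x], brings some cop onto the line
    of [s_x], and [A] grows.  When [A] contains every nonzero [x], the robber
    must eventually stand still, and the remaining cop walks to it. *)
Require Import Defs.
From HB Require Import structures.
From mathcomp Require Import all_boot all_order all_algebra.
From mathcomp Require Import perm boolp ring.

Import GRing.Theory Num.Theory.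
Local Open Scope ring_scope.

Set Implicit Arguments.
Unset Strict Implicit.
Unset Printing Implicit Defensive.

Lemma mkseqSl (T : Type) (f : nat -> T) n :
  mkseq f n.+1 = f 0%N :: mkseq (fun j => f j.+1) n.
Proof. by rewrite /mkseq -[RHS]/(f 0%N :: _) (map_comp f S) -(iotaDl 1). Qed.

(** * Reduction of the game to differences of positions *)

Section AbelianCayleyGame.
Variables (G : finZmodType) (S : {set G}).
Hypothesis S0 : 0 \in S.

Lemma stay_or_move_Cay (u v : G) : stay_or_move (Cay S) u v = (v - u \in S).
Proof. by rewrite /stay_or_move /=; case: eqP => [->|//]; rewrite subrr S0. Qed.

(* Positions with the robber to move; [d i] is cop [i] minus robber, which is
   all that matters because the graph is translation invariant. *)
Inductive cops_force (I : Type) (d : I -> G) : Prop :=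
| Caught i : d i = 0 -> cops_force d
| Respond (u : G -> I -> G) :
    (forall t i, t \in S -> u t i \in S) ->
    (forall t, t \in S -> cops_force (fun i => d i + u t i - t)) ->
    cops_force d.

(** Cop [j] imitates cop [f j]; [g] picks an imitator of the capturing cop. *)
Lemma cops_force_relabel (I J : Type) (f : J -> I) (g : I -> J) (d : I -> G) :
  cancel g f -> cops_force d -> cops_force (fun j => d (f j)).
Proof.
move=> gK; elim=> {}d => [i di0 | u uS _ IH].
  by apply: (@Caught _ _ (g i)); rewrite gK.
by apply: (@Respond _ _ (fun t j => u t (f j))) => [t j | t /IH //]; exact: uS.
Qed.

Definition strategy_from (I : Type) (c : I -> G) (r0 : G) (tau : seq G -> I -> G) :=
  [/\ tau [::] = c,
      forall h r i, stay_or_move (Cay S) (tau h i) (tau (rcons h r) i)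
    & forall r, robber_play (Cay S) r -> r 0%N = r0 ->
        exists n i, tau (mkseq (fun j => r j.+1) n) i = r n].

Lemma cops_force_strategy (I : Type) (d : I -> G) :
  cops_force d -> forall c r0, (forall i, d i = c i - r0) ->
  exists tau, strategy_from c r0 tau.
Proof.
elim=> {}d => [i di0 | u uS _ IH] c r0 dE.
  exists (fun _ => c); split=> // [h r j | r _ r00].
    by rewrite stay_or_move_Cay subrr.
  by exists 0%N, i; apply/eqP; rewrite r00 -subr_eq0 -dE di0.
have next r1 : exists tau : seq G -> I -> G,
    r1 - r0 \in S -> strategy_from (fun i => c i + u (r1 - r0) i) r1 tau.
  have [tS|_] := boolP (r1 - r0 \in S); last by exists (fun _ _ => 0).
  have [|tau tauP] := IH _ tS (fun i => c i + u (r1 - r0) i) r1.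
    by move=> i; rewrite dE opprB addrA; congr (_ - _); rewrite addrAC subrK.
  by exists tau.
have {next}[tau tauP] := boolp.choice next.
(* After an illegal robber move the cops freeze at [c], since legality is required for every
   history. *)
exists (fun h => if h is r1 :: h' then
  if r1 - r0 \in S then tau r1 h' else c else c).
split=> // [[|r1 h] r i /= | r rP r00].
- case: ifP => [tS|_]; last by rewrite stay_or_move_Cay subrr.
  by have [-> _ _] := tauP _ tS; rewrite stay_or_move_Cay addrC addKr uS.
- case: ifP => [tS|_]; last by rewrite stay_or_move_Cay subrr.
  by have [_ + _] := tauP _ tS; apply.
have tS : r 1%N - r0 \in S by rewrite -r00 -stay_or_move_Cay; apply: rP.
have [_ _ /(_ (fun n => r n.+1))[n|//|n [i capt]]] := tauP _ tS.
  exact: rP.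
by exists n.+1, i; rewrite mkseqSl tS capt.
Qed.

(** All cops start at [0] and pass their first turn, which leaves the robber to move from some
    difference vector. *)
Lemma cops_win_of_force (I : finType) :
  (forall d : I -> G, cops_force d) -> cops_win (Cay S) #|I|.
Proof.
move=> force; pose c (_ : I) : G := 0.
have [tau tauP] := boolp.choice (fun r0 =>
  cops_force_strategy (force (fun i => c i - r0)) (fun i => erefl)).
exists (fun h i => if h is r0 :: h' then tau r0 h' (enum_val i) else 0).
split=> [[|r0 h] r i /= | r rP].
- by have [-> _ _] := tauP r; rewrite stay_or_move_Cay subrr.
- by have [_ + _] := tauP r0; apply.
have [_ _ /(_ r rP erefl)[n [i capt]]] := tauP (r 0%N).
by exists n, (enum_rank i); right; rewrite mkseqSl enum_rankK.
Qed.

Section Evasion.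
Variable k : nat.
Hypothesis safe_start : forall c : 'I_k -> G, exists r, forall i, r - c i \notin S.
Hypothesis safe_move : forall (c : 'I_k -> G) r, (forall i, r != c i) ->
  exists2 r', r' - r \in S & forall i, r' - c i \notin S.

(** Invariant: after each robber turn no cop can reach the robber in one move, so the next cop turn
    captures nothing and [safe_move] applies again. *)
Lemma robber_evades : ~ cops_win (Cay S) k.
Proof.
case=> sigma [legal capt].
have [r0 r0P] := safe_start (sigma [::]).
have next (h : seq G) : exists r', (forall i, last r0 h != sigma h i) ->
    r' - last r0 h \in S /\ forall i, r' - sigma h i \notin S.
  have [free|] := pselect (forall i, last r0 h != sigma h i).
    by have [r' ? ?] := safe_move free; exists r'.
  by exists 0.
have {next}[nxt nxtP] := boolp.choice next.
pose hist n := iter n (fun h => rcons h (nxt h)) [:: r0].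
pose r n := last r0 (hist n).
have histE n : hist n = mkseq r n.+1.
  elim: n => [//|n IHn]; rewrite mkseqS -IHn.
  by rewrite /r /= last_rcons.
have free n : (forall i, r n - sigma (mkseq r n) i \notin S) ->
    forall i, last r0 (hist n) != sigma (hist n) i.
  move=> safe i; rewrite -/(r n); apply: contraNneq (safe i) => ->.
  rewrite histE mkseqS -stay_or_move_Cay; exact: legal.
have safe n i : r n - sigma (mkseq r n) i \notin S.
  elim: n i => [//|n /free/nxtP[_ IHn] i].
  by rewrite -histE /r /= last_rcons.
have rP : robber_play (Cay S) r.
  move=> n; rewrite stay_or_move_Cay {1}/r /= last_rcons.
  by have [] := nxtP _ (free n (safe n)).
have [n [i [E|E]]] := capt r rP.
  by have := safe n i; rewrite E subrr S0.
by have := free n (safe n) i; rewrite -/(r n) histE E eqxx.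
Qed.

End Evasion.
End AbelianCayleyGame.

(** * Forcing a capture by a decreasing measure *)

Section Descent.
Variables (G : finZmodType) (I : eqType) (X : Type) (s : X -> G) (S : {set G}).
Hypothesis sS : forall x, s x \in S.
Hypothesis Ss : forall t, t \in S -> exists x, t = s x.

Definition shift (d : I -> G) (j : I) (v : G) : I -> G :=
  fun i => if i == j then d i + v else d i.

(* Every cop but one copies the robber's move. *)
Lemma cops_force_shift (d : I -> G) :
  (forall x, exists j y, cops_force S (shift d j (s y - s x))) -> cops_force S d.
Proof.
move=> step.
have resp t : exists u : I -> G, t \in S ->
    (forall i, u i \in S) /\ cops_force S (fun i => d i + u i - t).
  have [/Ss[x ->]|_] := boolP (t \in S); last by exists (fun _ => 0).
  have [j [y F]] := step x; exists (fun i => if i == j then s y else s x) => _.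
  split=> [i|]; first by case: ifP.
  suff -> : (fun i => d i + (if i == j then s y else s x) - s x)
            = shift d j (s y - s x) by [].
  by apply/funext => i; rewrite /shift; case: ifP; rewrite -addrA // subrr addr0.
have [u uP] := boolp.choice resp.
by apply: (@Respond _ _ _ _ u) => [t i|t] /uP[].
Qed.

Lemma cops_force_descent (P : (I -> G) -> Prop) (psi : (I -> G) -> nat) :
  (forall d, P d -> cops_force S d \/
     forall x, exists j y, let d' := shift d j (s y - s x) in
       cops_force S d' \/ P d' /\ (psi d' < psi d)%N) ->
  forall d, P d -> cops_force S d.
Proof.
move=> H d; have [n] := ubnP (psi d); elim: n d => // n IHn d le_n /[dup] Pd /H[//|H'].
apply: cops_force_shift => x; have [j [y F]] := H' x; exists j, y.
by case: F => [//|[Pd' lt]]; apply: IHn => //; apply: leq_trans lt _.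
Qed.

End Descent.

Lemma sum_shift_lt (G : finZmodType) (I : finType) (B : {set I}) (g : G -> I -> nat)
    (d : I -> G) (j : I) (v : G) :
  j \in B -> (g (d j + v)%R j < g (d j) j)%N ->
  (\sum_(i in B) g (shift d j v i) i < \sum_(i in B) g (d i) i)%N.
Proof.
move=> jB lt; rewrite (bigD1 j) //= [X in (_ < X)%N](bigD1 j) //= {1}/shift eqxx.
rewrite -addSn leq_add //; apply: eq_leq; apply: eq_bigr => i /andP[_ /negPf ij].
by rewrite /shift ij.
Qed.

Lemma sum_shift_eq (G : finZmodType) (I : finType) (B : {set I}) (g : G -> I -> nat)
    (d : I -> G) (j : I) (v : G) :
  j \notin B ->
  (\sum_(i in B) g (shift d j v i) i = \sum_(i in B) g (d i) i)%N.
Proof.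
move=> jB; apply: eq_bigr => i iB; rewrite /shift.
by case: eqP => // ij; rewrite -ij iB in jB.
Qed.

(** * The game on the parabola *)

Section Parabola.
Variable p : nat.
Hypotheses (p_prime : prime p) (p_gt2 : (2 < p)%N).
Notation F := 'F_p.
Notation G := ('F_p * 'F_p)%type.

Definition parab (x : F) : G := (x, x ^+ 2).

Lemma parab_in x : parab x \in S2 p.
Proof. by apply/imsetP; exists x. Qed.

Lemma S2_parab t : t \in S2 p -> exists x, t = parab x.
Proof. by case/imsetP => x _ ->; exists x. Qed.

Lemma parab0 : parab 0 = 0.
Proof. by rewrite /parab expr0n. Qed.

Lemma zero_in_S2 : 0 \in S2 p.
Proof. by rewrite -parab0 parab_in. Qed.

Lemma card_S2 : #|S2 p| = p.
Proof. by rewrite card_imset ?card_Fp // => x y []. Qed.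

Lemma two_neq0 : (2%:R : F) != 0.
Proof.
by rewrite -(dvdn_pcharf (pchar_Fp p_prime)) gtnNdvd.
Qed.

(** Makes residues usable as measures: subtracting 1 wraps around only at 0. *)
Lemma Fp_pred_lt (v : F) : v != 0 -> ((v - 1)%R < v)%N.
Proof.
rewrite -{1 2}[v]natr_Zp; case: (nat_of_ord v) => [|n]; first by rewrite eqxx.
by move=> _; rewrite -natr1 addrK val_Fp_nat // ltnS leq_mod.
Qed.

(* A cop whose difference with the robber is [g] guards at most one move. *)
Lemma guarded_unique (g : G) x y :
  g != 0 -> g + parab x \in S2 p -> g + parab y \in S2 p -> x = y.
Proof.
case: g => a b g0 gx gy.
have guardE z : (a, b) + parab z \in S2 p -> b = a * (a + 2%:R * z).
  case/S2_parab => z' E; have Ez : a + z = z' := congr1 fst E.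
  have Ez2 : b + z ^+ 2 = z' ^+ 2 := congr1 snd E.
  by apply: (addIr (z ^+ 2)); rewrite Ez2 -Ez; ring.
have := guardE y gy; have Hx := guardE x gx.
have [a0|a0] := eqVneq a 0; first by move: g0; rewrite Hx a0 mul0r eqxx.
by rewrite Hx => /(mulfI a0)/addrI/(mulfI two_neq0).
Qed.

Lemma S2_cops_lower k : cops_win (Cay (S2 p)) k -> (p <= k)%N.
Proof.
move=> win; rewrite leqNgt; apply/negP => lt_kp; move: win.
apply: (robber_evades zero_in_S2) => [c | c r free].
  (* Otherwise sending each vertex to a cop reaching it and the move used would inject [p ^ 2]
     vertices into [k * p] pairs. *)
  apply: contrapT => /forallNP bad.
  have {}bad r : exists ix : 'I_k * F, r - c ix.1 = parab ix.2.
    by have /existsNP[i /negP/negPn/S2_parab[x ?]] := bad r; exists (i, x).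
  have [f fP] := boolp.choice bad.
  have /leq_card : injective f.
    by move=> r r' E; have := fP r; rewrite E -fP => /addIr.
  by rewrite !card_prod !card_Fp // card_ord leq_pmul2r ?prime_gt0 // leqNgt lt_kp.
apply: contrapT => bad.
have {}bad x : exists i, r - c i + parab x \in S2 p.
  apply: contrapT => /forallNP safe; apply: bad; exists (r + parab x).
    by rewrite addrC addKr parab_in.
  by move=> i; rewrite addrAC; apply/negP/safe.
have [f fP] := boolp.choice bad.
have /leq_card : injective f.
  by move=> x y E; apply: (guarded_unique _ (fP x)); rewrite ?subr_eq0 ?E.
by rewrite card_Fp // card_ord leqNgt lt_kp.
Qed.

(* [slope x] is the linear form with kernel the line spanned by [parab x]. *)
Definition slope (x : F) (g : G) : F := g.2 - x * g.1.

Lemma slopeD x g h : slope x (g + h) = slope x g + slope x h.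
Proof. by rewrite /slope /=; ring. Qed.

Lemma slopeB x g h : slope x (g - h) = slope x g - slope x h.
Proof. by rewrite /slope /=; ring. Qed.

Lemma slope_parab x y : slope x (parab y) = y * (y - x).
Proof. by rewrite /slope /=; ring. Qed.

Definition tracked (A : {set F}) (d : F -> G) := forall x, x \in A -> slope x (d x) = 0.

(** The coordinate of [g] along [parab x] when [slope x g = 0]: how many more plays of [parab x]
    lead to capture. *)
Definition tracking (g : G) (x : F) : nat := (g.1 / x : F).

Lemma tracked_shift A d j v :
  tracked A d -> j \notin A -> tracked A (shift d j v).
Proof.
move=> dA jA x xA; rewrite /shift; case: eqP => [E|_]; last exact: dA.
by rewrite -E xA in jA.
Qed.

(** Nested inductions: on the size of the complement of [A], then on [Phi], then on [psi] while [A]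
    is kept and [Phi] does not grow. *)
Lemma cops_force_tracked (A : {set F}) (d : F -> G) :
  0 \notin A -> tracked A d -> cops_force (S2 p) d.
Proof.
have [m] := ubnP #|~: A|; elim: m A d => // m IHm A d leA A0 dA.
have A_neq0 x : x \in A -> x != 0 by apply: contraTneq => ->.
have two0 := two_neq0.
pose Phi d := (\sum_(i in A) tracking (d i) i)%N.
have [n] := ubnP (Phi d); elim: n d dA => // n IHn d dA leN.
pose P d := tracked A d /\ (Phi d <= n)%N.
have P_shift d1 j v : P d1 -> j \notin A -> P (shift d1 j v).
  by case=> d1A le1 jA; split; [apply: tracked_shift | rewrite /Phi sum_shift_eq].
have play_tracked d1 x : P d1 -> ~ cops_force (S2 p) d1 -> x \in A ->
    cops_force (S2 p) (shift d1 x (parab 0 - parab x)).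
  case=> d1A le1 open xA; have x0 := A_neq0 x xA; apply: IHn.
    move=> y yA; rewrite /shift; case: eqP => [->|_]; last exact: d1A.
    by rewrite slopeD slopeB d1A // !slope_parab; ring.
  apply: leq_trans le1; apply: sum_shift_lt => //.
  rewrite /tracking parab0 sub0r -[(_ + _).1]/((d1 x).1 - x) mulrDl mulNr divff //; apply: Fp_pred_lt.
  rewrite mulf_neq0 ?invr_eq0 //; apply/eqP => E1; apply: open.
  apply: (@Caught _ _ _ _ x); have := d1A x xA; move: E1.
  by rewrite /slope; case: (d1 x) => a b /= ->; rewrite mulr0 subr0 => ->.
have [/existsP[x /andP[xA x0]] | /existsPn full] :=
    boolP [exists x, (x \notin A) && (x != 0)].
  pose B := ~: (0 |: A).
  have inB z : (z \in B) = (z != 0) && (z \notin A) by rewrite !inE negb_or.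
  (* The number of walks ([z = x]) or pauses ([z != x]) cop [z] needs to reach the line of
     [parab x]. *)
  pose w (g : G) z : nat :=
    if z == x then - slope x g / (2%:R * x ^+ 2) else slope x g / (z * (z - x)).
  pose psi d := (\sum_(i in B) w (d i) i)%N.
  apply: (cops_force_descent parab_in S2_parab (P := P) (psi := psi)) => // d1 Pd1.
  have [?|open] := pselect (cops_force (S2 p) d1); [by left | right => y].
  (* If cop [z] is on that line, exchanging the names [x] and [z], both outside [A], lets [x] join
     [A]. *)
  have sl0 z : z \in B -> slope x (d1 z) != 0.
    rewrite inB => /andP[z0 zA]; apply/eqP => sl; apply: open.
    suff: cops_force (S2 p) (fun i => d1 (tperm x z i)).
      move/(cops_force_relabel (@tpermK _ x z)).
      by under eq_fun do rewrite tpermK.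
    apply: (IHm (x |: A)).
    - rewrite -ltnS; apply: leq_trans leA; rewrite ltnS setCU setIC -setDE.
      by rewrite [X in (_ < X)%N](cardsD1 x) inE xA.
    - by rewrite !inE negb_or eq_sym x0.
    move=> i; rewrite !inE => /orP[/eqP->|iA]; first by rewrite tpermL.
    have [d1A _] := Pd1; rewrite tpermD ?d1A //; first by apply: contraNneq xA => ->.
    by apply: contraNneq zA => ->.
  have [yA|yA] := boolP (y \in A).
    by exists y, 0; left; apply: play_tracked.
  have [yx|] := boolP ((y == 0) || (y == x)).
    (* The moves [0] and [parab x] have slope 0, while [parab (- x)] has slope [2 * x ^ 2], which is
       nonzero. *)
    exists x, (- x); right; split; first exact: P_shift.
    apply: sum_shift_lt; first by rewrite inB x0.
    rewrite /w eqxx slopeD slopeB !slope_parab.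
    have -> : y * (y - x) = 0.
      by case/orP: yx => /eqP->; rewrite ?mul0r // subrr mulr0.
    have -> : - (slope x (d1 x) + (- x * (- x - x) - 0)) / (2%:R * x ^+ 2)
            = - slope x (d1 x) / (2%:R * x ^+ 2) - 1.
      by field; rewrite x0.
    apply: Fp_pred_lt; rewrite mulf_neq0 ?invr_eq0 ?mulf_neq0 ?expf_neq0 //.
    by rewrite oppr_eq0 sl0 // inB x0.
  rewrite negb_or => /andP[y0 yx]; have yB : y \in B by rewrite inB y0.
  exists y, 0; right; split; first exact: P_shift.
  apply: sum_shift_lt => //; rewrite /w (negPf yx) slopeD slopeB !slope_parab.
  have yx0 : y * (y - x) != 0 by rewrite mulf_neq0 // subr_eq0.
  rewrite mul0r sub0r mulrDl mulNr divff //; apply: Fp_pred_lt.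
  by rewrite mulf_neq0 ?invr_eq0 ?sl0.
pose al (g : G) : F := g.2 - 2%:R * g.1.
pose be (g : G) : F := (g.1 - g.2) / 2%:R.
(* [g = - al g *: parab 1 - be g *: parab 2] *)
pose psi (d : F -> G) := (al (d 0%R) + be (d 0%R))%N.
apply: (cops_force_descent parab_in S2_parab (P := P) (psi := psi)) => // d1 Pd1.
have [?|open] := pselect (cops_force (S2 p) d1); [by left | right => y].
have [yA|yA] := boolP (y \in A).
  by exists y, 0; left; apply: play_tracked.
have -> : y = 0 by apply/eqP; have := full y; rewrite yA negbK.
(* Whenever the robber stands still, cop [0] walks by [parab 1] until [al] vanishes, then by
   [parab 2] until [be] does. *)
have [al0|al0] := eqVneq (al (d1 0)) 0.
  exists 0, 2%:R; right; split; first exact: P_shift.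
  rewrite /psi /shift eqxx.
  have -> : al (d1 0 + (parab 2%:R - parab 0)) = al (d1 0) by rewrite /al /=; ring.
  have -> : be (d1 0 + (parab 2%:R - parab 0)) = be (d1 0) - 1.
    by rewrite /be /=; field.
  rewrite ltn_add2l; apply: Fp_pred_lt; rewrite mulf_neq0 ?invr_eq0 //.
  apply/eqP => be0; apply: open; apply: (@Caught _ _ _ _ 0).
  move: al0 be0; rewrite /al; case: (d1 0) => a b /= al0 /subr0_eq ab.
  rewrite ab in al0 *; by have -> : b = 0 by rewrite -[RHS]oppr0 -al0; ring.
exists 0, 1; right; split; first exact: P_shift.
rewrite /psi /shift eqxx.
have -> : al (d1 0 + (parab 1 - parab 0)) = al (d1 0) - 1 by rewrite /al /=; ring.
have -> : be (d1 0 + (parab 1 - parab 0)) = be (d1 0).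
  by rewrite /be /=; field.
by rewrite ltn_add2r Fp_pred_lt.
Qed.

Lemma S2_cops_upper : cops_win (Cay (S2 p)) p.
Proof.
have := @cops_win_of_force _ (S2 p) zero_in_S2 F; rewrite card_Fp //; apply=> d.
by apply: (@cops_force_tracked set0) => [|x]; rewrite inE.
Qed.

End Parabola.

Theorem theorem5p2 (p : nat) (p_prime : prime p) (p_gt3 : (3 < p)%N) :
  [/\ cop_number (Cay (S2 p)) = #|S2 p|,
      #|S2 p| = p
    & forall R : rcfType, p%:R = Num.sqrt (#|{: 'F_p * 'F_p}|%:R) :> R].
Proof.
have p_gt2 := ltnW p_gt3.
split=> [||R]; rewrite ?card_S2 //.
  rewrite /cop_number; case: ex_minnP => k /asboolP win min.
  apply/eqP; rewrite eqn_leq (S2_cops_lower p_prime p_gt2 win) andbT.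
  by apply: min; apply/asboolP; apply: S2_cops_upper.
by rewrite card_prod card_Fp // natrM -expr2 sqrtr_sqr ger0_norm ?ler0n.
Qed.
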